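(* Let $X$ be a real Banach space, let $f:[a,b]\to X$, and suppose that $md(f,\cdot)$ is continuous at $x\in[a,b]$. Then there exists $\delta>0$ such that $\bigvee_s^t f=\int_s^t md(f,y)\,dy$ for all $s<t$ with $s,t\in[x-\delta,x+\delta]\cap[a,b]$.
   Context: For $f:[a,b]\to X$, the unilateral metric derivatives are $md_{\pm}(f,x)=\lim_{t\to0+}\frac{\|f(x\pm t)-f(x)\|}{t}$. If both exist and are equal (and finite), their common value is the metric derivative $md(f,x)$; at an endpoint of $[a,b]$ only the one-sided limit taken inside $[a,b]$ is used. ''$md(f,\cdot)$ is continuous at $x$'' means that $md(f,s)$ exists for all $s\in[a,b]$ in some neighbourhood of $x$ and $md(f,s)\to md(f,x)$ as $s\to x$, $s\in[a,b]$. $\bigvee_s^t f$ denotes the total variation of $f$ on $[s,t]$. *)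

(* Defs.v *)
From HB Require Import structures.
From mathcomp Require Import all_boot all_order all_algebra.
From mathcomp Require Import all_classical all_reals all_analysis.

Set Implicit Arguments.
Unset Strict Implicit.
Unset Printing Implicit Defensive.

Import Order.TTheory GRing.Theory Num.Theory.
Import numFieldNormedType.Exports.

Local Open Scope classical_set_scope.
Local Open Scope ring_scope.

(* A map [a, b] -> X is represented by a total function f : R -> X. The notions
   below that take the bounds a and b as arguments only depend on the values of
   f on `[a, b]: the difference quotients are only considered as t -> 0+, on a
   side on which [a, b] extends beyond x. *)

Section MetricDerivative.
Context {R : realType} {X : normedModType R}.
Implicit Types (f : R -> X) (a b x t : R).

Definition rquot f x t : R := `|f (x + t) - f x| / t.
Definition lquot f x t : R := `|f (x - t) - f x| / t.

Definition md_right f x : R := lim (rquot f x t @[t --> 0^'+]).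
Definition md_left f x : R := lim (lquot f x t @[t --> 0^'+]).

(* Convergence is in R, hence the unilateral limits are finite. *)
Definition md_exists a b f x : Prop :=
  [/\ x \in `[a, b],
      x < b -> cvg (rquot f x t @[t --> 0^'+]),
      a < x -> cvg (lquot f x t @[t --> 0^'+]) &
      a < x -> x < b -> md_right f x = md_left f x].

(* Only meaningful when md_exists a b f x holds. *)
Definition md a b f x : R := if x < b then md_right f x else md_left f x.

Definition md_continuous_at a b f x : Prop :=
  (\forall s \near x, s \in `[a, b] -> md_exists a b f s) /\
  md a b f s @[s --> within `[a, b] (nbhs x)] --> md a b f x.

End MetricDerivative.

(* The library's variation, variations and total_variation are restricted to
   real-valued functions; these are the same definitions for a function with
   values in a normed module. *)
Section VectorVariation.
Context {R : realType} {X : normedModType R}.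
Implicit Types (f : R -> X) (s t : R) (l : seq R).

Definition vvariation s t f l : R := let F := f \o nth t (s :: l) in
  \sum_(0 <= n < size l) `|F n.+1 - F n|.

Definition vvariations s t f : set R :=
  [set vvariation s t f l | l in itv_partition s t].

Definition vtotal_variation s t f : \bar R :=
  ereal_sup [set v%:E | v in vvariations s t f].

End VectorVariation.

(* Main.v *)
(** Near [x] the metric derivative is bounded by some [K], so [f] is
    [K]-Lipschitz on a small interval [s, t]. Let [q_h y] be
    [|f (y + h) - f y| / h]; it is bounded by [K] and converges to [md f y], so
    its integral converges to that of [md f] by dominated convergence. On the
    other hand, for a continuous real function [G] the integral of
    [(G (y + h) - G y) / h] over [u, v] converges to [G v - G u]. Comparing [q_h]
    with the quotients of [G y = |f y - f u|] gives
    [|f v - f u| <= \int_u^v md f], hence an upper bound on the variation;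
    comparing it with those of [G y = - V_y^t f], which is Lipschitz because [f]
    is, gives the lower bound. *)

Require Import Defs.
From HB Require Import structures.
From mathcomp Require Import all_boot all_order all_algebra.
From mathcomp Require Import all_classical all_reals all_analysis.
From mathcomp Require Import measurable_realfun ring lra.

Set Implicit Arguments.
Unset Strict Implicit.
Unset Printing Implicit Defensive.

Import Order.TTheory GRing.Theory Num.Theory.
Import numFieldNormedType.Exports.

Local Open Scope classical_set_scope.
Local Open Scope ring_scope.

Lemma lipschitz_continuousW (R : realType) (X : normedModType R)
    (f : R -> X) (K : R) :
  (forall y z, y <= z -> `|f z - f y| <= K * (z - y)) -> continuous f.
Proof.
move=> fK y; apply/cvgrPdist_le => e e0.
have K1 : 0 < `|K| + 1 by rewrite ltr_pwDr.
have fK' z : `|f y - f z| <= (`|K| + 1) * `|y - z|.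
  have [yz|/ltW zy] := leP y z.
    rewrite distrC (le_trans (fK _ _ yz))// [`|y - z|]distrC
      [`|z - y|]ger0_norm ?subr_ge0//.
    by rewrite ler_wpM2r ?subr_ge0// ler_wpDr// ler_norm.
  rewrite (le_trans (fK _ _ zy))// [`|y - z|]ger0_norm ?subr_ge0//.
  by rewrite ler_wpM2r ?subr_ge0// ler_wpDr// ler_norm.
near=> z; rewrite (le_trans (fK' z))// -ler_pdivlMl// mulrC.
by near: z; apply: cvgr_dist_le => //; rewrite divr_gt0.
Unshelve. all: by end_near. Qed.

Lemma continuous_antiderivative (R : realType) (G : R -> R) (c : R) :
  continuous G ->
  exists P : R -> R, forall z, c < z -> is_derive z (1 : R) P (G z).
Proof.
move=> cG; exists (fun z => \int[lebesgue_measure]_(t in [set` `[c, z]]) G t).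
move=> z cz; have zz1 : z < z + 1 by rewrite ltrDl.
have [dP PE] := continuous_FTC1_closed zz1
  (continuous_compact_integrable (@segment_compact _ _ _)
    (continuous_subspaceT cG)) cz (cG z).
by apply: DeriveDef => //; rewrite -derive1E.
Qed.

Lemma integral_diff_quotient (R : realType) (G : R -> R) (u v : R) :
  u < v -> continuous G ->
  (\int[lebesgue_measure]_(y in `[u, v])
     ((G (y + n.+1%:R^-1) - G y) / n.+1%:R^-1)%:E)%E @[n --> \oo]
  --> (G v - G u)%:E.
Proof.
move=> uv cG; have [P dP] := continuous_antiderivative (u - 1) cG.
have gtu y : u <= y -> u - 1 < y by lra.
have Pquot z : u <= z ->
    (P (z + n.+1%:R^-1) - P z) / n.+1%:R^-1 @[n --> \oo] --> G z.
  move=> uz; have [dPz <-] := dP z (gtu _ uz).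
  have D : h^-1 *: ((P \o shift z) (h *: (1 : R)) - P z) @[h --> 0^']
    --> 'D_1 P z := dPz.
  have := (cvg_at_rightP _ _ _).1 (cvg_dnbhs_at_right D) harmonic.
  move=> /(_ (conj (@harmonic_gt0 _) (@cvg_harmonic _))).
  apply: cvg_trans; apply: near_eq_cvg; apply: nearW => n /=.
  by rewrite /GRing.scale /= mulr1 mulrC (addrC z).
have E n : (\int[lebesgue_measure]_(y in `[u, v])
     ((G (y + n.+1%:R^-1) - G y) / n.+1%:R^-1)%:E)%E =
   ((P (v + n.+1%:R^-1) - P v) / n.+1%:R^-1 -
    (P (u + n.+1%:R^-1) - P u) / n.+1%:R^-1)%:E.
  set h := n.+1%:R^-1; have h0 : 0 < h by rewrite invr_gt0.
  pose Q y := (P (y + h) - P y) / h.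
  pose g y := (G (y + h) - G y) / h.
  have dQ y : u <= y -> is_derive y (1 : R) Q (g y).
    move=> uy; rewrite /Q /g.
    have Dh := @is_derive1_comp _ P (shift h) _ _ _
      (dP (y + h) (gtu _ (ler_wpDr (ltW h0) uy)))
      (is_derive_shift y 1 h).
    have := is_deriveZ h^-1 (is_deriveB Dh (dP y (gtu _ uy))).
    rewrite mulr1 [_ *: _]mulrC; congr (is_derive _ _ _ _).
    by apply/funext => w /=; rewrite [LHS]mulrC.
  rewrite (@continuous_FTC2 _ g Q) //.
  - apply: continuous_subspaceT => y; rewrite /g.
    apply: cvgM; last exact: cvg_cst.
    apply: cvgB; last exact: cG.
    apply: continuous_comp; last exact: cG.
    by apply: cvgD; [exact: cvg_id|exact: cvg_cst].
  - split.
    + by move=> y /[!in_itv] /andP[/ltW /dQ []].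
    + apply: cvg_at_right_filter.
      have [/derivable1_diffP /differentiable_continuous] := dQ u (lexx _).
      by [].
    + apply: cvg_at_left_filter.
      have [/derivable1_diffP /differentiable_continuous] := dQ v (ltW uv).
      by [].
  - move=> y /[!in_itv] /andP[/ltW /dQ H _].
    by rewrite derive1E; case: H.
under eq_cvg do rewrite E.
apply: cvg_EFin; first exact: nearW.
by apply: cvgB; apply: Pquot; rewrite // ltW.
Qed.

Section VectorVariationTheory.
Context {R : realType} {X : normedModType R}.
Implicit Types (f : R -> X) (s t u z K : R) (l : seq R).

Lemma vvariation_nil s t f : vvariation s t f [::] = 0.
Proof. by rewrite /vvariation big_nil. Qed.

Lemma vvariation_cons s t f v l :
  vvariation s t f (v :: l) = `|f v - f s| + vvariation v t f l.
Proof. by rewrite /vvariation /= big_nat_recl. Qed.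

Lemma eq_vvariation s t f g l : {in `[s, t], f =1 g} -> itv_partition s t l ->
  vvariation s t f l = vvariation s t g l.
Proof.
elim: l s => [|v l IH] s fg sl; first by rewrite !vvariation_nil.
have vl := itv_partition_cons sl.
have [/andP[/ltW sv _] _] := sl; have vt := itv_partition_le vl.
rewrite !vvariation_cons !fg ?in_itv/= ?lexx ?sv ?vt ?(le_trans sv vt)//.
congr (_ + _); apply: IH => // y; rewrite in_itv /= => /andP[vy yt].
by apply: fg; rewrite in_itv /= (le_trans sv vy).
Qed.

Lemma vvariation_le_increment (f : R -> X) (g : R -> R) s t l :
  (forall y z, s <= y -> y <= z -> z <= t -> `|f z - f y| <= g z - g y) ->
  itv_partition s t l -> vvariation s t f l <= g t - g s.
Proof.
elim: l s => [|v l IH] s fg sl.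
  by rewrite vvariation_nil (itv_partition_nil sl) subrr.
have vl := itv_partition_cons sl.
have [/andP[/ltW sv _] _] := sl; have vt := itv_partition_le vl.
have vfg y z : v <= y -> y <= z -> z <= t -> `|f z - f y| <= g z - g y.
  by move=> vy; apply: fg; rewrite (le_trans sv).
have := IH v vfg vl; have := fg s v (lexx s) sv vt.
by rewrite vvariation_cons; lra.
Qed.

Section VariationFunction.
Variables (f : R -> X) (K t : R).
Hypothesis fK : forall y z, y <= z -> `|f z - f y| <= K * (z - y).

Let W y := sup (vvariations y t f).

Lemma has_sup_vvariations y : y <= t -> has_sup (vvariations y t f).
Proof.
move=> yt; split.
  move: yt; rewrite le_eqVlt => /predU1P[->|yt].
    by exists (vvariation t t f [::]), [::] => //; split => //=.
  by exists (vvariation y t f [:: t]), [:: t] => //; exact: itv_partition1.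
exists (K * t - K * y) => _ [l yl <-].
apply: (@vvariation_le_increment _ ( *%R K)) yl => u z _ uz _.
by rewrite -mulrBr; exact: fK.
Qed.

Lemma vvariation_le_sup y l : itv_partition y t l -> vvariation y t f l <= W y.
Proof.
move=> yl; apply: sup_upper_bound; last by exists l.
exact: has_sup_vvariations (itv_partition_le yl).
Qed.

(* Working with the variation on [y, t] rather than on [s, y] only requires
   prepending points to partitions. *)
Lemma sup_vvariations_increment y z : y <= z -> z <= t ->
  `|f z - f y| <= W y - W z.
Proof.
move=> yz zt; rewrite lerBrDr addrC -lerBrDr.
apply: ge_sup; first by have [] := has_sup_vvariations zt.
move=> _ [l [zl lt] <-]; rewrite lerBrDr addrC.
move: yz; rewrite le_eqVlt => /predU1P[->|yz].
  by rewrite subrr normr0 add0r; exact: vvariation_le_sup.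
by rewrite -vvariation_cons; apply: vvariation_le_sup; split => //=; rewrite yz.
Qed.

Lemma vvariation_le_split u z l : u <= z -> z <= t -> itv_partition u t l ->
  vvariation u t f l <= K * (z - u) + W z.
Proof.
elim: l u => [|v l IH] u uz zt ul.
  rewrite vvariation_nil.
  have tz : z = t by apply/eqP; rewrite eq_le zt -(itv_partition_nil ul).
  rewrite addr_ge0// ?(le_trans _ (fK uz))//.
  rewrite tz -(vvariation_nil t t f).
  by apply: vvariation_le_sup; split => //=.
have vl := itv_partition_cons ul; have [/andP[/ltW uv vp] lt] := ul.
rewrite vvariation_cons; have [vz|zv] := leP v z.
  have := IH v vz zt vl; have := fK uv; lra.
have : vvariation z t f (v :: l) <= W z.
  by apply: vvariation_le_sup; split => //=; rewrite zv.
rewrite vvariation_cons; have := fK uz; have := ler_distD (f z) (f v) (f u).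
lra.
Qed.

Lemma sup_vvariations_le y z : y <= z -> z <= t -> W y - W z <= K * (z - y).
Proof.
move=> yz zt; rewrite lerBlDr; apply: ge_sup.
  by have [] := has_sup_vvariations (le_trans yz zt).
by move=> _ [l yl <-]; exact: vvariation_le_split.
Qed.

Lemma vtotal_variationE y : y <= t -> vtotal_variation y t f = (W y)%:E.
Proof. by move=> /has_sup_vvariations[? ?]; exact: ereal_sup_EFin. Qed.

End VariationFunction.
End VectorVariationTheory.

Section MetricDerivativeIntegral.
Context {R : realType} {X : normedModType R}.
Variables (F : R -> X) (K : R) (m : R -> R).
Hypothesis FK : forall y z, y <= z -> `|F z - F y| <= K * (z - y).

Lemma continuous_rquot h : continuous (fun y => rquot F y h).
Proof.
have cF := lipschitz_continuousW FK.
move=> y; apply: cvgM; last exact: cvg_cst.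
apply: cvg_norm; apply: cvgB; last exact: cF.
apply: (@continuous_comp _ _ _ (fun y => y + h) F); last exact: cF.
by apply: cvgD; [exact: cvg_id|exact: cvg_cst].
Qed.

Lemma dominated_cvg_rquot u v :
  (forall y, u <= y -> y < v -> rquot F y t @[t --> 0^'+] --> m y) ->
  (@lebesgue_measure R).-integrable `[u, v] (EFin \o m) /\
  (\int[@lebesgue_measure R]_(y in `[u, v]) (rquot F y n.+1%:R^-1)%:E)%E
    @[n --> \oo] --> (\int[@lebesgue_measure R]_(y in `[u, v]) (m y)%:E)%E.
Proof.
move=> Fm.
have Fn y : u <= y -> y < v -> rquot F y n.+1%:R^-1 @[n --> \oo] --> m y.
  move=> uy yv; have := (cvg_at_rightP _ _ _).1 (Fm y uy yv) harmonic.
  by apply; split; [exact: harmonic_gt0|exact: cvg_harmonic].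
have mq n : measurable_fun `[u, v] (fun y => rquot F y n.+1%:R^-1).
  by apply: measurable_funTS; apply: continuous_measurable_fun;
     exact: continuous_rquot.
have mm : measurable_fun `[u, v] m.
  apply/measurable_fun_itv_bndo_bndcP.
  apply: (@measurable_fun_cvg _ _ _ _ (fun n y => rquot F y n.+1%:R^-1)).
    by move=> n; apply/measurable_fun_itv_bndo_bndcP.
  by move=> y /=; rewrite in_itv /= => /andP[uy yv]; exact: Fn.
have iK : (@lebesgue_measure R).-integrable `[u, v] (EFin \o cst K).
  apply: continuous_compact_integrable; first exact: segment_compact.
  by apply: continuous_subspaceT => y; exact: cvg_cst.
have [||im _ cm] := @dominated_convergence _ _ _ (@lebesgue_measure R) `[u, v]
  (measurable_itv _) (fun n y => (rquot F y n.+1%:R^-1)%:E) (EFin \o m)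
  (EFin \o cst K) (fun n => (measurable_EFinP _ _).2 (mq n))
  ((measurable_EFinP _ _).2 mm) _ iK.
- exists [set v]; split; [exact: measurable_set1|exact: lebesgue_measure_set1|].
  move=> y /=; apply: contra_notP => /eqP yv /[!in_itv]/= /andP[uy vy].
  by apply: cvg_EFin; [exact: nearW|apply: Fn; rewrite // lt_neqAle yv].
- apply: aeW => y n _ /=; rewrite lee_fin /rquot ger0_norm ?divr_ge0//.
  rewrite ler_pdivrMr ?invr_gt0// -[leRHS](_ : K * (y + n.+1%:R^-1 - y) = _).
    by apply: FK; rewrite lerDl.
  by rewrite addrC addKr.
by split.
Qed.

Section Comparison.
Variables (G : R -> R) (u v : R).
Hypothesis uv : u < v.
Hypothesis cG : continuous G.
Hypothesis Fm :
  forall y, u <= y -> y < v -> rquot F y t @[t --> 0^'+] --> m y.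

Let integrable_continuous (g : R -> R) : continuous g ->
  (@lebesgue_measure R).-integrable `[u, v] (EFin \o g).
Proof.
move=> cg; apply: continuous_compact_integrable; first exact: segment_compact.
exact: continuous_subspaceT.
Qed.

Let integrable_rquot h :
  (@lebesgue_measure R).-integrable `[u, v] (EFin \o (fun y => rquot F y h)).
Proof. exact/integrable_continuous/continuous_rquot. Qed.

Let integrable_diff_quotient h : (@lebesgue_measure R).-integrable `[u, v]
  (EFin \o (fun y => (G (y + h) - G y) / h)).
Proof.
apply: integrable_continuous => y; apply: cvgM; last exact: cvg_cst.
apply: cvgB; last exact: cG.
apply: (@continuous_comp _ _ _ (fun y => y + h) G); last exact: cG.
by apply: cvgD; [exact: cvg_id|exact: cvg_cst].
Qed.

Lemma le_integral_md :
  (forall y h, u <= y -> 0 < h -> G (y + h) - G y <= `|F (y + h) - F y|) ->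
  ((G v - G u)%:E <= \int[@lebesgue_measure R]_(y in `[u, v]) (m y)%:E)%E.
Proof.
move=> GF; have GE := integral_diff_quotient uv cG.
have [_ FE] := dominated_cvg_rquot Fm.
rewrite -(cvg_lim (@ereal_hausdorff R) GE) -(cvg_lim (@ereal_hausdorff R) FE).
apply: lee_lim; [exact: cvgP GE|exact: cvgP FE|apply: nearW => n].
apply: le_integral => // [||y]; [exact: integrable_diff_quotient|
  exact: integrable_rquot|rewrite inE /= in_itv /= => /andP[uy _]].
by rewrite lee_fin ler_wpM2r ?invr_ge0// GF ?invr_gt0.
Qed.

Lemma ge_integral_md :
  (forall y h, u <= y -> 0 < h -> `|F (y + h) - F y| <= G (y + h) - G y) ->
  (\int[@lebesgue_measure R]_(y in `[u, v]) (m y)%:E <= (G v - G u)%:E)%E.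
Proof.
move=> FG; have GE := integral_diff_quotient uv cG.
have [_ FE] := dominated_cvg_rquot Fm.
rewrite -(cvg_lim (@ereal_hausdorff R) GE) -(cvg_lim (@ereal_hausdorff R) FE).
apply: lee_lim; [exact: cvgP FE|exact: cvgP GE|apply: nearW => n].
apply: le_integral => // [||y]; [exact: integrable_rquot|
  exact: integrable_diff_quotient|rewrite inE /= in_itv /= => /andP[uy _]].
by rewrite lee_fin ler_wpM2r ?invr_ge0// FG ?invr_gt0.
Qed.

End Comparison.

Lemma norm_increment_le_integral u v : u <= v ->
  (forall y, u <= y -> y < v -> rquot F y t @[t --> 0^'+] --> m y) ->
  (`|F v - F u|%:E <= \int[@lebesgue_measure R]_(y in `[u, v]) (m y)%:E)%E.
Proof.
rewrite le_eqVlt => /predU1P[-> _|uv Fm].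
  by rewrite subrr normr0 set_itv1 integral_set1.
have cF := lipschitz_continuousW FK.
have cG : continuous (fun y => `|F y - F u|).
  by move=> y; apply: cvg_norm; apply: cvgB; [exact: cF|exact: cvg_cst].
have := le_integral_md uv cG Fm; rewrite subrr normr0 subr0; apply.
by move=> y h _ _; rewrite lerBlDr ler_distD.
Qed.

Lemma vtotal_variation_lipschitz s t : s < t -> (forall y, t <= y -> F y = F t) ->
  (forall y, s <= y -> y < t -> rquot F y h @[h --> 0^'+] --> m y) ->
  vtotal_variation s t F =
    (\int[@lebesgue_measure R]_(y in `[s, t]) (m y)%:E)%E.
Proof.
move=> st Ft Fm; have [im _] := dominated_cvg_rquot Fm.
have int_m u v : s <= u -> v <= t ->
    (@lebesgue_measure R).-integrable `[u, v] (EFin \o m).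
  move=> su vt; apply: integrableS im => //; apply: subset_itv; exact.
apply/eqP; rewrite eq_le; apply/andP; split.
  apply: ge_ereal_sup => _ [_ [l sl <-] <-].
  pose M y := \int[@lebesgue_measure R]_(x in `[s, y]) m x.
  have := @vvariation_le_increment _ _ F M s t l.
  rewrite [M s]/M set_itv1 Rintegral_set1 subr0 => /(_ _ sl) FM.
  rewrite -(fineK (integrable_fin_num _ im))// lee_fin; apply: FM.
  move=> y z sy yz zt; rewrite /M Rintegral_itvB ?bnd_simp//; last first.
    exact: int_m.
  rewrite Rintegral_itv_obnd_cbnd; last first.
    apply: integrableS (int_m y z sy zt) => //; exact: subset_itv_oc_cc.
  rewrite -lee_fin fineK; last exact/integrable_fin_num/int_m.
  apply: norm_increment_le_integral => // x yx xz.
  by apply: Fm; [exact: le_trans yx|exact: lt_le_trans zt].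
pose W y := sup (vvariations y t F).
pose G y := - W (Num.min y t).
have FG y z : y <= z -> `|F z - F y| <= G z - G y.
  move=> yz; rewrite /G /W opprK [leRHS]addrC.
  have [zt|/ltW tz] := leP z t.
    by rewrite (min_idPl (le_trans yz zt)) (sup_vvariations_increment FK).
  have [yt|/ltW ty] := leP y t; last by rewrite !Ft// !subrr normr0.
  by rewrite Ft// (sup_vvariations_increment FK).
have GK y z : y <= z -> `|G z - G y| <= K * (z - y).
  move=> yz; rewrite ger0_norm; last exact: le_trans (FG _ _ yz).
  rewrite /G /W opprK [leLHS]addrC; have [zt|/ltW tz] := leP z t.
    by rewrite (min_idPl (le_trans yz zt)) (sup_vvariations_le FK).
  have [yt|/ltW ty] := leP y t; last first.
    by rewrite subrr (le_trans (normr_ge0 _) (FK yz)).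
  rewrite (le_trans (sup_vvariations_le FK yt (lexx _)))//.
  by have := le_trans (normr_ge0 _) (FK tz); lra.
have cG := lipschitz_continuousW GK.
apply: le_trans (ge_integral_md st cG Fm _) _.
  by move=> y h _ h0; apply: FG; rewrite lerDl ltW.
rewrite (vtotal_variationE FK (ltW st)) lee_fin /G /W opprK minxx (min_idPl (ltW st)).
rewrite addrC gerDl oppr_le0.
by rewrite -(vvariation_nil t t F) (vvariation_le_sup FK).
Qed.

End MetricDerivativeIntegral.

Section LocalLipschitz.
Context {R : realType} {X : normedModType R}.
Implicit Types (f : R -> X) (a b c d s K : R).

Lemma locally_lipschitz_itv f c d K :
  (forall s, s \in `[c, d] -> \forall y \near s, y \in `[c, d] ->
    `|f y - f s| <= K * `|y - s|) ->
  forall y z, c <= y -> y <= z -> z <= d -> `|f z - f y| <= K * (z - y).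
Proof.
move=> fK u v cu uv vd.
pose A := [set y | [/\ u <= y, y <= v & `|f y - f u| <= K * (y - u)]].
have Au : A u by split; rewrite ?lexx// !subrr normr0 mulr0.
have hA : has_sup A by split; [exists u|exists v => y []].
have us : u <= sup A by exact: sup_upper_bound.
have sv : sup A <= v by apply: ge_sup; [exists u|move=> y []].
have scd : sup A \in `[c, d] by rewrite in_itv /= (le_trans cu us) (le_trans sv vd).
have [e /= e0 He] := fK _ scd.
have As : A (sup A).
  split => //; have [y Ay sey] := sup_adherent e0 hA.
  have ys := sup_upper_bound hA Ay; case: Ay => uy yv fy.
  have := He y; rewrite /= (ger0_norm (_ : 0 <= sup A - y)) ?subr_ge0//.
  rewrite in_itv /= (le_trans cu uy) (le_trans yv vd) => /(_ _ isT).
  rewrite [`|f y - _|]distrC [`|y - _|]distrC (ger0_norm (_ : 0 <= sup A - y)) ?subr_ge0//.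
  have H : sup A - y < e by lra.
  move=> /(_ H) fs; have := ler_distD (f y) (f (sup A)) (f u); lra.
move: sv; rewrite le_eqVlt => /predU1P[<-|sv]; first by case: As.
pose z := Num.min v (sup A + e / 2).
have sz : sup A < z by rewrite /z lt_min sv/=; lra.
have ze : z <= sup A + e / 2 by rewrite /z ge_min lexx orbT.
have zv : z <= v by rewrite /z ge_min lexx.
suff Az : A z by have := sup_upper_bound hA Az; rewrite leNgt sz.
split => //; first by rewrite (le_trans us)// ltW.
have := He z; rewrite /= distrC (gtr0_norm (_ : 0 < z - sup A)) ?subr_gt0//.
rewrite in_itv /= (le_trans zv vd) (le_trans cu (le_trans us (ltW sz))).
have H : z - sup A < e by lra.
move=> /(_ H isT) fs; have := ler_distD (f (sup A)) (f z) (f u).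
case: As => _ _; lra.
Qed.

Lemma cvg_rquot_md a b f s : md_exists a b f s -> s < b ->
  rquot f s t @[t --> 0^'+] --> md a b f s.
Proof. by move=> [_ + _ _] sb; rewrite /md sb; exact. Qed.

Lemma cvg_lquot_md a b f s : md_exists a b f s -> a < s ->
  lquot f s t @[t --> 0^'+] --> md a b f s.
Proof.
move=> [_ _ cl E] as_; rewrite /md; case: ifPn => [sb|_]; last exact: cl.
by rewrite E//; exact: cl.
Qed.

Lemma md_locally_lipschitz a b f s K : md_exists a b f s -> md a b f s < K ->
  \forall y \near s, y \in `[a, b] -> `|f y - f s| <= K * `|y - s|.
Proof.
move=> mds sK.
have R0 : \forall t \near 0^'+, s < b -> rquot f s t <= K.
  have [sb|_] := boolP (s < b); last exact: nearW.
  have H : \forall t \near 0^'+, rquot f s t <= K.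
    by apply: (cvgr_le (md a b f s) (cvg_rquot_md mds sb)).
  by apply: filterS H.
have L0 : \forall t \near 0^'+, a < s -> lquot f s t <= K.
  have [as_|_] := boolP (a < s); last exact: nearW.
  have H : \forall t \near 0^'+, lquot f s t <= K.
    by apply: (cvgr_le (md a b f s) (cvg_lquot_md mds as_)).
  by apply: filterS H.
have [e /= e0 He] := filterI R0 L0.
exists e => //= y /= ye /[!in_itv]/= /andP[ay yb].
have [sy|ys|->] := ltgtP s y; last by rewrite !subrr !normr0 mulr0.
- have ys0 : 0 < y - s by rewrite subr_gt0.
  have [|+ _] := He (y - s) _ ys0; first by rewrite /= sub0r normrN distrC.
  by rewrite /rquot subrKC ler_pdivrMr// gtr0_norm//; apply; exact: lt_le_trans yb.
- have ys0 : 0 < s - y by rewrite subr_gt0.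
  have [|_] := He (s - y) _ ys0; first by rewrite /= sub0r normrN.
  rewrite /lquot subKr ler_pdivrMr// [`|y - s|]distrC (gtr0_norm ys0).
  by apply; exact: le_lt_trans ys.
Qed.

End LocalLipschitz.

Theorem lemma4p2 (R : realType) (X : completeNormedModType R)
    (a b : R) (f : R -> X) (x : R) :
  x \in `[a, b] ->
  md_continuous_at a b f x ->
  exists delta : R, 0 < delta /\
    forall s t : R, s < t ->
      s \in `[a, b] -> s \in `[x - delta, x + delta] ->
      t \in `[a, b] -> t \in `[x - delta, x + delta] ->
      (@lebesgue_measure R).-integrable `[s, t] (fun y => (md a b f y)%:E) /\
      vtotal_variation s t f =
        (\int[@lebesgue_measure R]_(y in `[s, t]) (md a b f y)%:E)%E.
Proof.
move=> xab [ex cx]; pose K := md a b f x + 1.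
have mdK : \forall s \near x, s \in `[a, b] -> md a b f s < K.
  by apply: (cvgr_lt (md a b f x) cx); rewrite ltrDl.
have [e /= e0 He] := filterI ex mdK.
exists (e / 2); split; first by rewrite divr_gt0.
move=> s t st; rewrite !in_itv/=.
move=> /andP[as_ sb] /andP[xs _] /andP[at_ tb] /andP[_ tx].
have Hst y : s <= y -> y <= t -> md_exists a b f y /\ md a b f y < K.
  move=> sy yt; have yab : y \in `[a, b].
    by rewrite in_itv/= (le_trans as_ sy) (le_trans yt tb).
  have [|/(_ yab) ? /(_ yab) ?//] := He y.
  by rewrite /= ltr_distlC; apply/andP; split; lra.
have fK : forall y z, s <= y -> y <= z -> z <= t -> `|f z - f y| <= K * (z - y).
  apply: locally_lipschitz_itv => y; rewrite in_itv/= => /andP[sy yt].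
  have [ey yK] := Hst y sy yt.
  move: (md_locally_lipschitz ey yK); apply: filterS => z.
  move=> + /[!in_itv]/= /andP[sz zt].
  by apply; rewrite in_itv/= (le_trans as_ sz) (le_trans zt tb).
have K0 : 0 <= K.
  have := le_trans (normr_ge0 _) (fK s t (lexx s) (ltW st) (lexx t)).
  by rewrite pmulr_lge0// subr_gt0.
(* [f] may be irregular outside [s, t], whereas the quotients at points of
   [s, t] also see values beyond [t]. *)
pose F y := f (Num.max s (Num.min y t)).
have Ff y : s <= y -> y <= t -> F y = f y.
  by move=> sy yt; rewrite /F (min_idPl yt) (max_idPr sy).
have FK y z : y <= z -> `|F z - F y| <= K * (z - y).
  move=> yz; have tm : Num.max s (Num.min z t) <= t.
    by rewrite ge_max (ltW st) ge_min lexx orbT.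
  apply: le_trans (fK _ _ _ _ tm) _.
  - by rewrite le_max lexx.
  - by rewrite le_max2// le_min2.
  - rewrite ler_wpM2l//.
    by rewrite !maxEle !minEle; do ! case: ifPn; rewrite -?ltNge; lra.
have Ft y : t <= y -> F y = F t.
  by move=> ty; rewrite /F minxx (min_idPr ty).
have Fmd y : s <= y -> y < t -> rquot F y h @[h --> 0^'+] --> md a b f y.
  move=> sy yt; have [ey _] := Hst y sy (ltW yt).
  apply: cvg_trans (cvg_rquot_md ey (lt_le_trans yt tb)).
  apply: near_eq_cvg; near=> h; rewrite /rquot (Ff y sy (ltW yt)) Ff//.
    by rewrite (le_trans sy)// lerDl.
  by rewrite -lerBrDl; near: h; apply: nbhs_right_le; rewrite subr_gt0.
have [im _] := dominated_cvg_rquot FK Fmd; split; first exact: im.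
rewrite -(vtotal_variation_lipschitz FK st Ft Fmd) /vtotal_variation.
congr (ereal_sup (image _ _)); apply: eq_imagel => l sl.
apply: eq_vvariation sl => y; rewrite in_itv/= => /andP[sy yt].
by rewrite Ff.
Unshelve. all: by end_near. Qed.
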